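(* Let $\mathbf{J}=-\mathbf{J}^T\in\mathbb{R}^{N,N}$, let $\mathbf{R}=\mathbf{R}^T\in\mathbb{R}^{N,N}$ be positive semi-definite, $\mathbf{B}_i\in\mathbb{R}^{n_i,m}$ for $i=1,2,3$, $N=n_1+n_2+n_3$, let $H=H(z_1,z_2)$ be a (continuously differentiable, not necessarily quadratic) Hamiltonian on $\mathbb{R}^{n_1+n_2}$, and let $\overline{\nabla}H$ be a discrete gradient of $H$ with components $\overline{\partial_{z_1}}H$ (first $n_1$ entries) and $\overline{\partial_{z_2}}H$ (last $n_2$ entries). Let $\tau>0$ be the step size and set $H^n=H(z_1^n,z_2^n)$. Abbreviate $\overline{\partial_{z_k}}H^{n,n+1}=\overline{\partial_{z_k}}H\big([z_1^n;z_2^n],[z_1^{n+1};z_2^{n+1}]\big)$ for $k=1,2$. Then the discrete gradient scheme $$\begin{bmatrix}\tau\,\overline{\partial_{z_1}}H^{n,n+1}\\ z_2^{n+1}-z_2^n\\ 0\end{bmatrix}=(\mathbf{J}-\mathbf{R})\begin{bmatrix}z_1^{n+1}-z_1^n\\ \tau\,\overline{\partial_{z_2}}H^{n,n+1}\\ \tau z_3^{n+1/2}\end{bmatrix}+\tau\begin{bmatrix}\mathbf{B}_1\\ \mathbf{B}_2\\ \mathbf{B}_3\end{bmatrix}u^{n+1/2},$$ $$\tau y^{n+1/2}=\begin{bmatrix}\mathbf{B}_1^T&\mathbf{B}_2^T&\mathbf{B}_3^T\end{bmatrix}\begin{bmatrix}z_1^{n+1}-z_1^n\\ \tau\,\overline{\partial_{z_2}}H^{n,n+1}\\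 \tau z_3^{n+1/2}\end{bmatrix}$$ satisfies $$H^{n+1}-H^n\le\tau\,\langle y^{n+1/2},u^{n+1/2}\rangle$$ and, in particular, $H^{n+1}\le H^n$ for vanishing inputs.
   Context: The scheme is a time discretization of the system $[\partial_{z_1}H;\dot z_2;0]=(\mathbf{J}-\mathbf{R})[\dot z_1;\partial_{z_2}H;z_3]+[\mathbf{B}_1;\mathbf{B}_2;\mathbf{B}_3]u$, $y=[\mathbf{B}_1^T\ \mathbf{B}_2^T\ \mathbf{B}_3^T][\dot z_1;\partial_{z_2}H;z_3]$ with state $z=[z_1;z_2;z_3]\in\mathbb{R}^{n_1+n_2+n_3}$ and $\mathbb{R}^m$-valued input $u$ and output $y$, on equidistant time points $t^n=n\tau$. $z_j^n\in\mathbb{R}^{n_j}$ denotes the approximation of $z_j(t^n)$; $z_3^{n+1/2}=\tfrac12(z_3^n+z_3^{n+1})$; $u^{n+1/2}=u(t^n+\tau/2)\in\mathbb{R}^m$; and $y^{n+1/2}\in\mathbb{R}^m$ is defined by the second equation of the scheme. $\langle x,y\rangle=x^Ty$ is the Euclidean inner product, $[x;y]$ denotes vertical stacking. Discrete gradient: with $d=n_1+n_2$, a continuous map $\overline{\nabla}H\colon\mathbb{R}^d\times\mathbb{R}^d\to\mathbb{R}^d$ is called a discrete gradient of $H\colon\mathbb{R}^d\to\mathbb{R}$ if for all $z,z'\in\mathbb{R}^d$ $$\overline{\nabla}H(z,z)=\nabla H(z)\quad\text{and}\quad\big\langle\overline{\nabla}H(z,z'),z'-z\big\rangle=H(z')-H(z).$$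 *)

(* Defs.v *)
From HB Require Import structures.
From mathcomp Require Import all_boot all_order all_algebra.
From mathcomp Require Import all_classical all_reals all_analysis.
Import Order.TTheory GRing.Theory Num.Theory numFieldNormedType.Exports.

Set Implicit Arguments.
Unset Strict Implicit.
Unset Printing Implicit Defensive.

Local Open Scope classical_set_scope.
Local Open Scope ring_scope.

Definition inner (R : realType) (d : nat) (x y : 'cV[R]_d) : R :=
  (x^T *m y) ord0 ord0.

Definition psdmx (R : realType) (d : nat) (A : 'M[R]_d) : Prop :=
  forall x : 'cV[R]_d, 0 <= inner x (A *m x).

Definition stack3 (R : realType) (p n1 n2 n3 : nat) (A1 : 'M[R]_(n1, p))
    (A2 : 'M[R]_(n2, p)) (A3 : 'M[R]_(n3, p)) : 'M[R]_(n1 + n2 + n3, p) :=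
  col_mx (col_mx A1 A2) A3.

Definition gradient (R : realType) (d : nat) (H : 'cV[R]_d -> R)
    (z : 'cV[R]_d) : 'cV[R]_d :=
  \col_(i < d) 'D_(delta_mx i ord0) H z.

Definition continuously_differentiable (R : realType) (d : nat)
    (H : 'cV[R]_d -> R) : Prop :=
  (forall z, differentiable H z) /\ continuous (gradient H).

Definition discrete_gradient (R : realType) (d : nat) (H : 'cV[R]_d -> R)
    (dH : 'cV[R]_d -> 'cV[R]_d -> 'cV[R]_d) : Prop :=
  [/\ continuous (fun p : 'cV[R]_d * 'cV[R]_d => dH p.1 p.2),
      forall z, dH z z = gradient H z
    & forall z z', inner (dH z z') (z' - z) = H z' - H z].

Section Scheme.
Variables (R : realType) (n1 n2 n3 m : nat).
Variables (J Rm : 'M[R]_(n1 + n2 + n3)).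
Variables (B1 : 'M[R]_(n1, m)) (B2 : 'M[R]_(n2, m)) (B3 : 'M[R]_(n3, m)).
Variable (dH : 'cV[R]_(n1 + n2) -> 'cV[R]_(n1 + n2) -> 'cV[R]_(n1 + n2)).
Variable (tau : R).
Variables (z1 : nat -> 'cV[R]_n1) (z2 : nat -> 'cV[R]_n2)
  (z3 : nat -> 'cV[R]_n3).

Definition dH1 (n : nat) : 'cV[R]_n1 :=
  usubmx (dH (col_mx (z1 n) (z2 n)) (col_mx (z1 n.+1) (z2 n.+1))).

Definition dH2 (n : nat) : 'cV[R]_n2 :=
  dsubmx (dH (col_mx (z1 n) (z2 n)) (col_mx (z1 n.+1) (z2 n.+1))).

Definition z3_half (n : nat) : 'cV[R]_n3 := 2^-1 *: (z3 n + z3 n.+1).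

(* the midpoint t^n + tau / 2 of the n-th time step, with t^n = n tau *)
Definition t_half (n : nat) : R := n%:R * tau + tau / 2.

Definition scheme_effort (n : nat) : 'cV[R]_(n1 + n2 + n3) :=
  stack3 (z1 n.+1 - z1 n) (tau *: dH2 n) (tau *: z3_half n).

Definition scheme_state (u : R -> 'cV[R]_m) (n : nat) : Prop :=
  stack3 (tau *: dH1 n) (z2 n.+1 - z2 n) 0 =
  (J - Rm) *m scheme_effort n + tau *: (stack3 B1 B2 B3 *m u (t_half n)).

(* y n stands for y^{n + 1/2} *)
Definition scheme_output (y : nat -> 'cV[R]_m) (n : nat) : Prop :=
  tau *: y n = row_mx (row_mx B1^T B2^T) B3^T *m scheme_effort n.

End Scheme.

(* Main.v *)
(** Pair the state equation with the effort vector e. The left side yields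
    tau * (H^{n+1} - H^n) by the discrete gradient identity, J contributes
    nothing by skew-symmetry, R contributes a nonpositive term, and B^T e is
    tau * y by the output equation. Dividing by tau gives the estimate. *)

Require Import Defs.
From HB Require Import structures.
From mathcomp Require Import all_boot all_order all_algebra.
From mathcomp Require Import all_classical all_reals all_analysis.
From mathcomp Require Import lra.
Import Order.TTheory GRing.Theory Num.Theory numFieldNormedType.Exports.

Local Open Scope ring_scope.

Section Inner.
Variable R : realType.

Lemma innerC (d : nat) (x y : 'cV[R]_d) : inner x y = inner y x.
Proof. by rewrite /inner -{1}(trmxK y) -trmx_mul mxE. Qed.

Lemma innerDr (d : nat) (x y z : 'cV[R]_d) :
  inner x (y + z) = inner x y + inner x z.
Proof. by rewrite /inner mulmxDr mxE. Qed.

Lemma innerNr (d : nat) (x y : 'cV[R]_d) : inner x (- y) = - inner x y.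
Proof. by rewrite /inner mulmxN mxE. Qed.

Lemma innerZr (d : nat) (a : R) (x y : 'cV[R]_d) :
  inner x (a *: y) = a * inner x y.
Proof. by rewrite /inner -scalemxAr mxE. Qed.

Lemma innerZl (d : nat) (a : R) (x y : 'cV[R]_d) :
  inner (a *: x) y = a * inner x y.
Proof. by rewrite innerC innerZr innerC. Qed.

Lemma innerx0 (d : nat) (x : 'cV[R]_d) : inner x 0 = 0.
Proof. by rewrite /inner mulmx0 mxE. Qed.

Lemma inner_col_mx (d1 d2 : nat) (x1 y1 : 'cV[R]_d1) (x2 y2 : 'cV[R]_d2) :
  inner (col_mx x1 x2) (col_mx y1 y2) = inner x1 y1 + inner x2 y2.
Proof. by rewrite /inner tr_col_mx mul_row_col mxE. Qed.

Lemma inner_mulmxr (d1 d2 : nat) (A : 'M[R]_(d1, d2)) x y :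
  inner x (A *m y) = inner (A^T *m x) y.
Proof. by rewrite /inner trmx_mul trmxK mulmxA. Qed.

(** A matrix and its transpose have the same quadratic form, so skew-symmetry makes the value equal
    to its own negative. *)
Lemma inner_skew (d : nat) (A : 'M[R]_d) (x : 'cV[R]_d) :
  A = - A^T -> inner x (A *m x) = 0.
Proof.
move=> A_skew; have : inner x (A *m x) = - inner x (A *m x).
  by rewrite {1}A_skew mulNmx innerNr inner_mulmxr innerC.
lra.
Qed.

End Inner.

Theorem lemma2p8 (R : realType) (n1 n2 n3 m : nat)
  (J Rm : 'M[R]_(n1 + n2 + n3))
  (B1 : 'M[R]_(n1, m)) (B2 : 'M[R]_(n2, m)) (B3 : 'M[R]_(n3, m))
  (H : 'cV[R]_(n1 + n2) -> R)
  (dH : 'cV[R]_(n1 + n2) -> 'cV[R]_(n1 + n2) -> 'cV[R]_(n1 + n2))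
  (tau : R)
  (z1 : nat -> 'cV[R]_n1) (z2 : nat -> 'cV[R]_n2) (z3 : nat -> 'cV[R]_n3)
  (u : R -> 'cV[R]_m) (y : nat -> 'cV[R]_m) (n : nat)
  (J_skew : J = - J^T) (R_sym : Rm = Rm^T) (R_psd : psdmx Rm)
  (H_C1 : continuously_differentiable H)
  (dH_dg : discrete_gradient H dH)
  (tau_gt0 : 0 < tau)
  (state_eq : scheme_state J Rm B1 B2 B3 dH tau z1 z2 z3 u n)
  (output_eq : scheme_output B1 B2 B3 dH tau z1 z2 z3 y n) :
  H (col_mx (z1 n.+1) (z2 n.+1)) - H (col_mx (z1 n) (z2 n))
    <= tau * inner (y n) (u (t_half tau n))
  /\ (u (t_half tau n) = 0 ->
      H (col_mx (z1 n.+1) (z2 n.+1)) <= H (col_mx (z1 n) (z2 n))).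
Proof.
set e := scheme_effort dH tau z1 z2 z3 n.
have supply : inner e (stack3 B1 B2 B3 *m u (t_half tau n))
    = tau * inner (y n) (u (t_half tau n)).
  (* The transposed stack of the [B] blocks is the block row of the output equation. *)
  by rewrite inner_mulmxr /stack3 !tr_col_mx -output_eq innerZl.
have storage : inner e (stack3 (tau *: dH1 dH z1 z2 n) (z2 n.+1 - z2 n) 0)
    = tau * (H (col_mx (z1 n.+1) (z2 n.+1)) - H (col_mx (z1 n) (z2 n))).
  case: dH_dg => _ _ <-.
  (* Splitting the discrete gradient into its two blocks allows a blockwise comparison; the third
     block of [e] meets 0. *)
  rewrite opp_col_mx add_col_mx -[dH _ _]vsubmxK /e /scheme_effort /stack3.
  rewrite !inner_col_mx innerx0 addr0 innerZr innerZl mulrDr.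
  (* In the first block [e] carries the increment, in the second the gradient; only the first needs
     symmetry. *)
  by rewrite (innerC _ _ (z1 n.+1 - z1 n)).
have balance : H (col_mx (z1 n.+1) (z2 n.+1)) - H (col_mx (z1 n) (z2 n))
    <= tau * inner (y n) (u (t_half tau n)).
  (* Scaling by [tau] makes the left side the storage term, so the state equation can be
     substituted. *)
  rewrite -(ler_pM2l tau_gt0) -storage state_eq innerDr mulmxBl innerDr.
  rewrite innerNr innerZr (inner_skew _ _ _ _ J_skew) supply.
  (* The supply term [tau * (tau * inner (y n) (u (t_half tau n)))] now stands on both sides and
     cancels; what is left is semi-definiteness of [Rm] at [e]. *)
  by rewrite sub0r gerDr oppr_le0.
by split=> // u0; move: balance; rewrite u0 innerx0 mulr0 subr_le0.
Qed.
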